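(* Let $(V,V^+,e)$ be an AOU space. (i) $\operatorname{OMAX}(V)$ is an operator system structure on $(V,V^+,e)$. (ii) If $(V, \{ P_n \}_{n=1}^{\infty}, e)$ is any operator system structure on $(V,V^+,e)$, then $C_n^{\max}(V) \subseteq P_n$ for all $n \ge 1$. (iii) If $\mathcal{S}$ is any operator system and $\phi: V \to \mathcal{S}$ is a unital positive linear map, then $\phi: \operatorname{OMAX}(V) \to \mathcal{S}$ is completely positive. Moreover, if $\tilde{V} = (V,\{C_n\}_{n=1}^{\infty},e)$ is an operator system structure on $V$ with $C_1 = V^+$ and such that for every operator system $W$ any unital positive linear map $\Psi : \tilde{V}\rightarrow W$ is completely positive, then the identity map is a unital complete order isomorphism from $\tilde{V}$ onto $\operatorname{OMAX}(V)$.
   Context: A $*$-vector space is a complex vector space $V$ with a conjugate-linear involution $*$; $V_h=\{v: v^*=v\}$. An ordered $*$-vector space $(V,V^+)$ has a cone $V^+\subseteq V_h$ (closed under sums and nonnegative real multiples) with $V^+\cap -V^+=\{0\}$; $v\ge w$ means $v-w\in V^+$. An order unit is $e\in V_h$ such that for each $v\in V_h$ there is $r>0$ with $re\ge v$; it is Archimedean if $v\in V$ and $re+v\ge0$ for all $r>0$ imply $v\in V^+$. An AOU space $(V,V^+,e)$ is an ordered $*$-vector space with an Archimedean order unit. $M_n(V)$ carries the involution $(a_{i,j})^*=(a_{j,i}^* )$ and is identified with $M_n\otimes V$. A matrix ordering on $V$ is a family $\{C_n\}_{n\ge1}$ of cones $C_n\subseteq M_n(V)_h$ with $C_n\cap -C_n=\{0\}$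 and $X^*C_nX\subseteq C_m$ for all $X\in M_{n,m}(\mathbb{C})$. An operator system is a triple $(V,\{C_n\},e)$ with $\{C_n\}$ a matrix ordering and $e\in V_h$ such that $e_n=\operatorname{diag}(e,\dots,e)\in M_n(V)$ is an Archimedean order unit for $(M_n(V),C_n)$ for each $n$. An operator system structure on the AOU space $(V,V^+,e)$ is a matrix ordering $\{C_n\}$ with $C_1=V^+$ such that $(V,\{C_n\},e)$ is an operator system. A linear map $\phi$ is positive if it maps the first cone into the first cone, unital if it maps the distinguished unit to the distinguished unit, and completely positive if $\phi_n((v_{i,j}))=(\phi(v_{i,j}))$ maps the $n$-th cone into the $n$-th cone for every $n$; a complete order isomorphism is an invertible $\phi$ with $\phi$ and $\phi^{-1}$ completely positive. Let $D_n^{\max}(V)=\{\sum_{i=1}^k a_i\otimes v_i: a_i\in M_n^+, v_i\in V^+, k\in\mathbb{N}\}$, $C_n^{\max}(V)=\{A\in M_n(V): re_n+A\in D_n^{\max}(V)\text{ for all }r>0\}$, and $\operatorname{OMAX}(V)=(V,\{C_n^{\max}(V)\}_{n=1}^\infty,e)$. *)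

(* Defs.v *)
From HB Require Import structures.
From mathcomp Require Import all_boot all_order all_algebra.
From mathcomp Require Import classical_sets reals.
From mathcomp Require Import complex.

Set Implicit Arguments.
Unset Strict Implicit.
Unset Printing Implicit Defensive.

Import Order.TTheory GRing.Theory Num.Theory.

Local Open Scope ring_scope.
Local Open Scope classical_set_scope.
Local Open Scope complex_scope.
Local Open Scope sesquilinear_scope.

HB.mixin Record isStarLmodule (R : realType) V of GRing.Lmodule R[i] V := {
  star : V -> V;
  starD : forall u v, star (u + v) = star u + star v;
  starZ : forall (a : R[i]) v, star (a *: v) = Num.conj a *: star v;
  starK : involutive star
}.

#[short(type="starLmodType")]
HB.structure Definition StarLmodule (R : realType) :=
  {V of isStarLmodule R V & GRing.Lmodule R[i] V}.

(* M_n(V). A type alias is needed because the scaling that the library puts on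
   'M[V]_n is by elements of V, for V a ring; here scalars are complex. *)
Definition starmx (R : realType) (V : starLmodType R) (n : nat) : Type :=
  'M[V]_n.

Section StarMatrix.
Variables (R : realType) (V : starLmodType R) (n : nat).

HB.instance Definition _ := GRing.Zmodule.on (starmx V n).

Definition starmx_scale (a : R[i]) (A : starmx V n) : starmx V n :=
  map_mx (fun v : V => a *: v) A.

Fact starmx_scaleA a b A :
  starmx_scale a (starmx_scale b A) = starmx_scale (a * b) A.
Proof. by apply/matrixP => i j; rewrite !mxE scalerA. Qed.

Fact starmx_scale1 : left_id 1 starmx_scale.
Proof. by move=> A; apply/matrixP => i j; rewrite !mxE scale1r. Qed.

Fact starmx_scaleDr : right_distributive starmx_scale +%R.
Proof. by move=> a A B; apply/matrixP => i j; rewrite !mxE scalerDr. Qed.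

Fact starmx_scaleDl A : {morph starmx_scale^~ A : a b / a + b}.
Proof. by move=> a b; apply/matrixP => i j; rewrite !mxE scalerDl. Qed.

HB.instance Definition _ := GRing.Zmodule_isLmodule.Build R[i] (starmx V n)
  starmx_scaleA starmx_scale1 starmx_scaleDr starmx_scaleDl.

Definition starmx_star (A : starmx V n) : starmx V n :=
  \matrix_(i, j) star ((A : 'M[V]_n) j i).

Fact starmx_starD A B : starmx_star (A + B) = starmx_star A + starmx_star B.
Proof. by apply/matrixP => i j; rewrite !mxE starD. Qed.

Fact starmx_starZ (a : R[i]) A :
  starmx_star (a *: A) = Num.conj a *: starmx_star A.
Proof. by apply/matrixP => i j; rewrite !mxE starZ. Qed.

Fact starmx_starK : involutive starmx_star.
Proof. by move=> A; apply/matrixP => i j; rewrite !mxE starK. Qed.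

HB.instance Definition _ := isStarLmodule.Build R (starmx V n)
  starmx_starD starmx_starZ starmx_starK.

End StarMatrix.

Section AOU.
Variables (R : realType) (V : starLmodType R).
Implicit Types (K : set V) (e : V).

Definition selfadjoint : set V := [set v | star v = v].

Definition cone K : Prop :=
  [/\ K !=set0,
      (forall u v, K u -> K v -> K (u + v)) &
      (forall (r : R) v, 0 <= r -> K v -> K (r%:C *: v))].

Definition ordered_star_space K : Prop :=
  [/\ cone K, K `<=` selfadjoint & K `&` [set - v | v in K] = [set 0]].

Definition order_unit K e : Prop :=
  selfadjoint e /\
  forall v, selfadjoint v -> exists2 r : R, 0 < r & K (r%:C *: e - v).

Definition archimedean K e : Prop :=
  forall v, (forall r : R, 0 < r -> K (r%:C *: e + v)) -> K v.

Definition AOU_space K e : Prop :=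
  [/\ ordered_star_space K, order_unit K e & archimedean K e].

End AOU.

Section OperatorSystem.
Variables (R : realType) (V : starLmodType R).

(* A family of cones is indexed by all n : nat; the value at n = 0 is junk and
   never constrained nor used. *)
Implicit Types (C : forall n, set (starmx V n)) (e : V).

Definition mxcompress (n m : nat) (X : 'M[R[i]]_(n, m)) (A : starmx V n) :
    starmx V m :=
  \matrix_(i, j) \sum_k \sum_l (X^t* i k * X l j) *: (A : 'M[V]_n) k l.

Definition mxunit (n : nat) e : starmx V n := \matrix_(i, j) (e *+ (i == j)).

Definition matrix_ordering C : Prop :=
  (forall n, (0 < n)%N -> ordered_star_space (C n)) /\
  (forall n m, (0 < n)%N -> (0 < m)%N ->
    forall (X : 'M[R[i]]_(n, m)) A, C n A -> C m (mxcompress X A)).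

Definition operator_system C e : Prop :=
  [/\ matrix_ordering C, selfadjoint e &
      forall n, (0 < n)%N -> AOU_space (C n) (mxunit n e)].

Definition first_cone C : set V := [set v | C 1%N (const_mx v)].

Definition operator_system_structure (Vp : set V) e C : Prop :=
  [/\ matrix_ordering C, first_cone C = Vp & operator_system C e].

End OperatorSystem.

Definition positive (R : realType) (V W : starLmodType R)
    (Vp : set V) (Wp : set W) (phi : V -> W) : Prop :=
  forall v, Vp v -> Wp (phi v).

Definition unital (R : realType) (V W : starLmodType R)
    (e : V) (f : W) (phi : V -> W) : Prop := phi e = f.

Definition completely_positive (R : realType) (V W : starLmodType R)
    (C : forall n, set (starmx V n)) (D : forall n, set (starmx W n))
    (phi : V -> W) : Prop :=
  forall n, (0 < n)%N ->
    forall A : starmx V n, C n A -> D n (map_mx phi A : starmx W n).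

Definition complete_order_isomorphism (R : realType) (V W : starLmodType R)
    (C : forall n, set (starmx V n)) (D : forall n, set (starmx W n))
    (phi : {linear V -> W}) : Prop :=
  exists psi : W -> V,
    [/\ cancel phi psi, cancel psi phi,
        completely_positive C D phi & completely_positive D C psi].

Section OMAX.
Variables (R : realType) (V : starLmodType R) (Vp : set V) (e : V).

Definition psdmx (n : nat) : set 'M[R[i]]_n :=
  [set a | a \is hermsymmx /\
           forall x : 'cV[R[i]]_n, 0 <= (x^t* *m a *m x) 0 0].

Definition mxtensor (n : nat) (a : 'M[R[i]]_n) (v : V) : starmx V n :=
  \matrix_(i, j) (a i j *: v).

Definition Dmax (n : nat) : set (starmx V n) :=
  [set A | exists (k : nat) (a : 'I_k -> 'M[R[i]]_n) (v : 'I_k -> V),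
     [/\ forall i, psdmx (a i), forall i, Vp (v i) &
         A = \sum_(i < k) mxtensor (a i) (v i)]].

Definition Cmax (n : nat) : set (starmx V n) :=
  [set A | forall r : R, 0 < r -> Dmax (r%:C *: mxunit n e + A)].

End OMAX.

Arguments Dmax {R V} Vp n _.
Arguments Cmax {R V} Vp e n _.

(* Main.v *)
Require Import Defs.
From HB Require Import structures.
From mathcomp Require Import all_boot all_order all_algebra.
From mathcomp Require Import classical_sets reals.
From mathcomp Require Import complex.

Set Implicit Arguments.
Unset Strict Implicit.
Unset Printing Implicit Defensive.

Import Order.TTheory GRing.Theory Num.Theory.

Local Open Scope ring_scope.
Local Open Scope classical_set_scope.

(** Elements of [Dmax n] are sums of [a (x) v] with [a] psd and [v >= 0].
    Compressing by a column sends them into [Vp], and [Vp] is Archimedean, so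
    every column compresses [Cmax n] into [Vp]; by polarization [Cmax n] is then
    proper.  That [e_n] is an order unit follows by writing a self-adjoint
    matrix as a sum of tensors [h (x) v] with [h] hermitian and [v] self-adjoint
    and using [h <= r 1] for large [r].  For the universal property, the
    spectral theorem gives [a = b^* b], so that [a (x) v] is the sum of the
    compressions of [v] by the rows of [b]; hence any matrix ordering whose
    first cone contains [phi Vp] contains the image of [Dmax n], and of [Cmax n]
    by the Archimedean property.  The remaining claims are the universal property
    applied to identity maps. *)

(** * Positive semidefinite and hermitian complex matrices *)

Section PositiveSemidefinite.
Local Open Scope complex_scope.
Local Open Scope sesquilinear_scope.
Variable R : realType.
Implicit Types (n m : nat) (c : R[i]).

(** The order of [R[i]] compares only numbers with equal imaginary part. This links scalars of the
    cones, taken in [R], with values of quadratic forms, taken in [R[i]]. *)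
Lemma ge0_real_complex c : 0 <= c -> exists2 r : R, 0 <= r & c = r%:C.
Proof.
move=> c0; have cr : (complex.Re c)%:C = c by rewrite RRe_real ?ger0_real.
by exists (complex.Re c) => //; rewrite -ler0c cr.
Qed.

Lemma conj_real (r : R) : Num.conj (r%:C) = r%:C.
Proof. by apply/CrealP; rewrite complex_real. Qed.

Lemma trmxC_mul m n p (A : 'M[R[i]]_(m, n)) (B : 'M[R[i]]_(n, p)) :
  (A *m B)^t* = B^t* *m A^t*.
Proof. by rewrite trmx_mul map_mxM. Qed.

Lemma trmxC_E m n (A : 'M[R[i]]_(m, n)) i j : (A^t*) i j = Num.conj (A j i).
Proof. by rewrite !mxE. Qed.

Lemma hermsymmxP n (a : 'M[R[i]]_n) : reflect (a^t* = a) (a \is hermsymmx).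
Proof. by apply: (iffP (is_hermitianmxP _ _ _)); rewrite expr0 scale1r. Qed.

Lemma psdmxP n (a : 'M[R[i]]_n) :
  psdmx a <->
  a^t* = a /\ forall x : 'cV[R[i]]_n, 0 <= (x^t* *m a *m x) 0 0.
Proof. by split=> -[/hermsymmxP]. Qed.

Lemma psdmx0 n : psdmx (0 : 'M[R[i]]_n).
Proof.
apply/psdmxP; split; first by rewrite trmx0 map_mx0.
by move=> x; rewrite mulmx0 mul0mx mxE.
Qed.

Lemma psdmxZ n c (a : 'M[R[i]]_n) : 0 <= c -> psdmx a -> psdmx (c *: a).
Proof.
move=> c0 /psdmxP[ha pa]; apply/psdmxP; split.
  by rewrite linearZ /= map_mxZ ha /= conj_Creal // ger0_real.
by move=> x; rewrite -scalemxAr -scalemxAl mxE mulr_ge0.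
Qed.

Lemma psdmx1 n : psdmx (1%:M : 'M[R[i]]_n).
Proof.
apply/psdmxP; split; first by rewrite trmx1 map_mx1.
move=> x; rewrite mulmx1 mxE sumr_ge0 // => k _.
by rewrite trmxC_E mulrC mul_conjC_ge0.
Qed.

Lemma psdmx_congr n m (X : 'M[R[i]]_(n, m)) a :
  psdmx a -> psdmx (X^t* *m a *m X).
Proof.
move=> /psdmxP[ha pa]; apply/psdmxP; split.
  by rewrite !trmxC_mul trmxCK ha mulmxA.
by move=> x; have := pa (X *m x); rewrite trmxC_mul !mulmxA.
Qed.

(** The modulus of [x^* h x] is at most the sum of all [|h i j| |x i| |x j|], hence at most
    [s |x|^2] with [s] the sum of the [|h i j|]. Taking [s + 1] keeps the bound strictly positive
    when [h = 0]. *)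
Lemma hermsymmx_bounded n (h : 'M[R[i]]_n) :
  h^t* = h -> exists2 r : R, 0 < r & psdmx (r%:C%:M - h).
Proof.
move=> hh;
have M0 : 0 <= \sum_i \sum_j `|h i j|.
  by apply: sumr_ge0 => i _; apply: sumr_ge0.
have [s s0 sE] := ge0_real_complex M0.
exists (s + 1); first by rewrite ltr_wpDl.
apply/psdmxP; split.
  by rewrite linearB /= map_mxB tr_scalar_mx map_scalar_mx /= conj_real hh.
move=> x; rewrite mulmxBr mulmxBl mxE [X in _ + X]mxE subr_ge0.
set S := (x^t* *m x) 0 0.
have SE : S = \sum_k `|x k 0| ^+ 2.
  by rewrite /S mxE; apply: eq_bigr => k _; rewrite trmxC_E normCK mulrC.
have S0 : 0 <= S by rewrite SE sumr_ge0 // => k _; rewrite exprn_ge0.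
have le_S k : `|x k 0| ^+ 2 <= S.
  by rewrite SE (bigD1 k) //= lerDl sumr_ge0 // => l _; rewrite exprn_ge0.
(* [R[i]] is only partially ordered, but norms are real and so comparable; the product is at most
   the larger of the two squares. *)
have le_S2 k l : `|x k 0| * `|x l 0| <= S.
  case/orP: (real_leVge (normr_real (x k 0)) (normr_real (x l 0))) => le_xx.
    by apply: le_trans (le_S l); rewrite expr2 ler_wpM2r.
  by apply: le_trans (le_S k); rewrite expr2 ler_wpM2l.
rewrite -scalemx1 -scalemxAr mulmx1 -scalemxAl [leRHS]mxE -/S.
rewrite rmorphD rmorph1 /= -sE.
(* A value of the form can be compared with its modulus only once it is known to be real, which
   hermitian symmetry gives. *)
have real_f : (x^t* *m h *m x) 0 0 \is Num.real.
  by apply/CrealP; rewrite -trmxC_E !trmxC_mul trmxCK hh mulmxA.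
apply: le_trans (real_ler_norm real_f) _.
apply: (@le_trans _ _ ((\sum_i \sum_j `|h i j|) * S)); last first.
  by rewrite ler_wpM2r // lerDl.
rewrite mxE exchange_big /= mulr_suml; apply: le_trans (ler_norm_sum _ _ _) _.
apply: ler_sum => l _; rewrite mxE mulr_suml mulr_suml.
apply: le_trans (ler_norm_sum _ _ _) _; apply: ler_sum => k _.
by rewrite trmxC_E !normrM norm_conjC mulrAC mulrC ler_wpM2l.
Qed.

(** Diagonalize [a = P^* d P] with [P] unitary and take [b = sqrt(d) P]. *)
Lemma psdmx_factor n (a : 'M[R[i]]_n) :
  psdmx a -> exists b : 'M[R[i]]_n, a = b^t* *m b.
Proof.
move=> [ha pa]; have /orthomx_spectralP := hermitian_normalmx ha.
set P := spectralmx a; set d := spectral_diag a => aE.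
have PU : P \is unitarymx by apply: spectral_unitarymx.
have PP : P *m P^t* = 1%:M by apply/unitarymxP.
(* The matrix [P a P^*] is diagonal, so each eigenvalue is the value of the form of [a] at a column
   of [P^*]. *)
have d0 i : 0 <= d 0 i.
  have := pa (P^t* *m delta_mx i 0); rewrite trmxC_mul trmxCK {1}aE.
  rewrite invmx_unitary // !mulmxA -(mulmxA _ P) PP mulmx1 -(mulmxA _ P) PP.
  rewrite mulmx1 trmx_delta map_delta_mx -rowE.
  by rewrite -colE !mxE eqxx mulr1n.
exists (diag_mx (map_mx sqrtC d) *m P).
rewrite {1}aE invmx_unitary // trmxC_mul tr_diag_mx map_diag_mx !mulmxA.
congr (_ *m _); rewrite -!mulmxA; congr (_ *m _); rewrite mulmx_diag.
congr diag_mx; apply/rowP=> i; rewrite !mxE /= conj_Creal.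
  by rewrite -expr2 sqrtCK.
by rewrite ger0_real ?sqrtC_ge0.
Qed.

End PositiveSemidefinite.

(** * Elementary tensors, compressions and polarization in M_n(V) *)

Section MatricesOverStarSpace.
Local Open Scope complex_scope.
Local Open Scope sesquilinear_scope.
Variables (R : realType) (V : starLmodType R).
Implicit Types (n m : nat) (c : R[i]) (v w e : V).

Lemma starmxD_E n (A B : starmx V n) i j :
  (A + B : 'M[V]_n) i j = (A : 'M[V]_n) i j + (B : 'M[V]_n) i j.
Proof. by rewrite mxE. Qed.

Lemma starmxN_E n (A : starmx V n) i j :
  (- A : 'M[V]_n) i j = - (A : 'M[V]_n) i j.
Proof. by rewrite mxE. Qed.

Lemma starmxZ_E n c (A : starmx V n) i j :
  (c *: A : starmx V n) i j = c *: (A : 'M[V]_n) i j.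
Proof. by rewrite mxE. Qed.

Lemma starmx_sum_E n I (r : seq I) (P : pred I) (F : I -> starmx V n) i j :
  (\sum_(k <- r | P k) F k : starmx V n) i j =
  \sum_(k <- r | P k) (F k : 'M[V]_n) i j.
Proof. exact: (summxE r P (F : I -> 'M[V]_n)). Qed.

Lemma star0 (W : starLmodType R) : star (0 : W) = 0.
Proof. by rewrite -[0 in LHS](scale0r (0 : W)) starZ conjC0 scale0r. Qed.

Lemma starN (W : starLmodType R) (w : W) : star (- w) = - star w.
Proof. by rewrite -scaleN1r starZ rmorphN rmorph1 scaleN1r. Qed.

Lemma mxtensorDl n (a b : 'M[R[i]]_n) v :
  mxtensor (a + b) v = mxtensor a v + mxtensor b v.
Proof. by apply/matrixP => i j; rewrite starmxD_E !mxE scalerDl. Qed.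

Lemma mxtensorDr n (a : 'M[R[i]]_n) v w :
  mxtensor a (v + w) = mxtensor a v + mxtensor a w.
Proof. by apply/matrixP => i j; rewrite starmxD_E !mxE scalerDr. Qed.

Lemma mxtensorZl n c (a : 'M[R[i]]_n) v :
  mxtensor (c *: a) v = c *: mxtensor a v.
Proof. by apply/matrixP => i j; rewrite starmxZ_E !mxE scalerA. Qed.

Lemma mxtensorZr n c (a : 'M[R[i]]_n) v :
  mxtensor a (c *: v) = c *: mxtensor a v.
Proof.
by apply/matrixP => i j; rewrite starmxZ_E !mxE !scalerA mulrC.
Qed.

Lemma mxtensorNl n (a : 'M[R[i]]_n) v : mxtensor (- a) v = - mxtensor a v.
Proof. by rewrite -scaleN1r mxtensorZl scaleN1r. Qed.

Lemma mxtensorNr n (a : 'M[R[i]]_n) v : mxtensor a (- v) = - mxtensor a v.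
Proof. by rewrite -scaleN1r mxtensorZr scaleN1r. Qed.

Lemma mxunitE n e : mxunit n e = mxtensor 1%:M e.
Proof.
by apply/matrixP => i j; rewrite !mxE -scalerMnl scale1r.
Qed.

Lemma star_mxtensor n (a : 'M[R[i]]_n) v :
  star (mxtensor a v) = mxtensor (a^t*) (star v).
Proof. by apply/matrixP => i j; rewrite !mxE starZ. Qed.

Lemma mxcompressD n m (X : 'M[R[i]]_(n, m)) (A B : starmx V n) :
  mxcompress X (A + B) = mxcompress X A + mxcompress X B.
Proof.
apply/matrixP => i j; rewrite starmxD_E !mxE -big_split; apply: eq_bigr => k _.
by rewrite -big_split; apply: eq_bigr => l _; rewrite starmxD_E scalerDr.
Qed.

Lemma mxcompressZ n m (X : 'M[R[i]]_(n, m)) c (A : starmx V n) :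
  mxcompress X (c *: A) = c *: mxcompress X A.
Proof.
apply/matrixP => i j; rewrite starmxZ_E !mxE scaler_sumr; apply: eq_bigr => k _.
rewrite scaler_sumr; apply: eq_bigr => l _.
by rewrite starmxZ_E !scalerA mulrC.
Qed.

Lemma mxcompressN n m (X : 'M[R[i]]_(n, m)) (A : starmx V n) :
  mxcompress X (- A) = - mxcompress X A.
Proof. by rewrite -scaleN1r mxcompressZ scaleN1r. Qed.

Lemma mxcompress0 n m (X : 'M[R[i]]_(n, m)) :
  mxcompress X (0 : starmx V n) = 0.
Proof. by rewrite -[0 in LHS](scale0r 0) mxcompressZ scale0r. Qed.

Lemma mxcompress_tensor n m (X : 'M[R[i]]_(n, m)) a v :
  mxcompress X (mxtensor a v) = mxtensor (X^t* *m a *m X) v.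
Proof.
apply/matrixP => i j; rewrite !mxE scaler_suml exchange_big.
apply: eq_bigr => l _; rewrite mxE mulr_suml scaler_suml.
by apply: eq_bigr => k _; rewrite !mxE scalerA mulrAC.
Qed.

(** Expansion in matrix units; it reduces additive claims about M_n(V) to elementary tensors. *)
Lemma starmx_sum_delta n (A : starmx V n) :
  A = \sum_i \sum_j mxtensor (delta_mx i j) ((A : 'M[V]_n) i j).
Proof.
apply/matrixP => k l; rewrite starmx_sum_E.
under eq_bigr => i _.
  rewrite starmx_sum_E; under eq_bigr => j _ do rewrite !mxE; over.
rewrite (bigD1 k) //= (bigD1 l) //= !eqxx scale1r big1 ?addr0 => [|j jl].
  rewrite big1 ?addr0 // => i ik; apply: big1 => j _.
  by rewrite eq_sym (negbTE ik) scale0r.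
by rewrite eq_sym (negbTE jl) scale0r.
Qed.

Lemma map_mxtensor (W : starLmodType R) (phi : {linear V -> W}) n
    (a : 'M[R[i]]_n) v :
  map_mx phi (mxtensor a v) = mxtensor a (phi v).
Proof. by apply/matrixP => i j; rewrite !mxE linearZ. Qed.

Lemma const_mx1E v : const_mx v = mxtensor 1%:M v :> starmx V 1.
Proof. by apply/matrixP => i j; rewrite !mxE !ord1 scale1r. Qed.

(** [b^* b] is the sum of the rank-one matrices [row^* row] over the rows of [b], and each
    [row^* row (x) v] is a compression of the 1 by 1 matrix [v]. This is how the first cone controls
    all the others. *)
Lemma mxtensor_factor n (b : 'M[R[i]]_n) v :
  mxtensor (b^t* *m b) v =
  \sum_k mxcompress (row k b) (const_mx v : starmx V 1).
Proof.
apply/matrixP => i j; rewrite starmx_sum_E !mxE scaler_suml.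
apply: eq_bigr => k _.
by rewrite const_mx1E mxcompress_tensor mulmx1 !mxE big_ord1 !mxE.
Qed.

(* Polarization: evaluate [x^* A x] at the vectors [e_k], [e_k + e_l] and
   [e_k + sqrt(-1) e_l]. *)
Lemma mxcompress_eq0 n (A : starmx V n) :
  (forall x : 'cV[R[i]]_n, mxcompress x A = 0) -> A = 0.
Proof.
move=> A0; pose f (x : 'cV[R[i]]_n) (k l : 'I_n) : V :=
  (Num.conj (x k 0) * x l 0) *: (A : 'M[V]_n) k l.
have f0 x : \sum_k \sum_l f x k l = 0.
  have /matrixP /(_ 0 0) := A0 x; rewrite !mxE => sum0; rewrite -[RHS]sum0.
  by apply: eq_bigr => k _; apply: eq_bigr => l _; rewrite /f !mxE.
have f1 (i j : 'I_n) a b (x := a *: delta_mx i 0 + b *: delta_mx j 0) :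
  i != j -> \sum_k \sum_l f x k l =
    (Num.conj a * a) *: (A : 'M[V]_n) i i
    + (Num.conj a * b) *: (A : 'M[V]_n) i j
    + ((Num.conj b * a) *: (A : 'M[V]_n) j i
    + (Num.conj b * b) *: (A : 'M[V]_n) j j).
  move=> ij; have ji : (j == i) = false by rewrite eq_sym (negbTE ij).
  have xi : x i 0 = a.
    by rewrite !mxE !eqxx (negbTE ij) /= mulr1 mulr0 addr0.
  have xj : x j 0 = b by rewrite !mxE !eqxx ji /= mulr1 mulr0 add0r.
  have x0 k : k != i -> k != j -> x k 0 = 0.
    by move=> /negbTE ki /negbTE kj; rewrite !mxE ki kj /= !mulr0 addr0.
  have sum2 (F : 'I_n -> V) : (forall k, k != i -> k != j -> F k = 0) ->
      \sum_k F k = F i + F j.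
    move=> F0; rewrite (bigD1 i) //= (bigD1 j) 1?eq_sym //= big1 ?addr0 //.
    by move=> k /andP[ki kj]; apply: F0.
  rewrite sum2; last first.
    move=> k ki kj; apply: big1 => l _.
    by rewrite /f x0 // conjC0 mul0r scale0r.
  by congr (_ + _); rewrite sum2 ?/f ?xi ?xj // => l li lj;
    rewrite x0 // mulr0 scale0r.
have Aii i : (A : 'M[V]_n) i i = 0.
  have := f0 (delta_mx i 0); rewrite (bigD1 i) //= [X in _ + X]big1 ?addr0.
    rewrite (bigD1 i) //= [X in _ + X]big1 ?addr0.
      by rewrite /f !mxE !eqxx conjC1 mulr1 scale1r.
    by move=> l /negbTE li; rewrite /f !mxE li mulr0 scale0r.
  move=> k /negbTE ki; rewrite big1 // => l _.
  by rewrite /f !mxE ki conjC0 mul0r scale0r.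
apply/matrixP => i j; rewrite [RHS]mxE.
have [->|ij] := eqVneq i j; first exact: Aii.
(* The diagonal being zero, the vector [e_i + e_j] gives [A_ij + A_ji = 0], and then [e_i + 'i e_j]
   gives ['i (A_ij - A_ji) = 0]; together they force [A_ji = 0] and [A_ij = 0]. *)
have /eqP := f1 i j 1 1 ij; rewrite f0 !Aii conjC1 !scaler0 add0r addr0 !mulr1.
rewrite !scale1r eq_sym addr_eq0 => /eqP AijN.
have /eqP := f1 i j 1 'i ij; rewrite f0 !Aii conjC1 !scaler0 add0r addr0.
rewrite mul1r mulr1 conjCi AijN scaleNr scalerN -opprD eq_sym oppr_eq0.
rewrite -scalerDl scaler_eq0 -mulr2n mulrn_eq0 /= (negbTE (neq0Ci _)) /=.
by move=> /eqP ->; rewrite oppr0.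
Qed.

End MatricesOverStarSpace.

(** * Closure properties of cones *)

Section Cones.
Local Open Scope complex_scope.
Variables (R : realType) (V : starLmodType R) (K : set V).
Hypothesis coneK : cone K.

Lemma cone0 : K 0.
Proof.
by case: coneK => -[v Kv] _ KZ; rewrite -(scale0r v); apply: (KZ 0 v).
Qed.

Lemma coneD u v : K u -> K v -> K (u + v).
Proof. by case: coneK => _ KD _; exact: KD. Qed.

Lemma coneZ (c : R[i]) v : 0 <= c -> K v -> K (c *: v).
Proof.
by case: coneK => _ _ KZ /ge0_real_complex[r r0 ->]; exact: KZ.
Qed.

Lemma cone_sum n (F : 'I_n -> V) : (forall i, K (F i)) -> K (\sum_i F i).
Proof. by move=> KF; apply: big_ind => //; [exact: cone0|exact: coneD]. Qed.

(** Dominating the vector 0 puts some [r e] with [r > 0] in the cone; then divide by [r]. *)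
Lemma order_unit_in_cone e : order_unit K e -> K e.
Proof.
move=> [_ /(_ 0 (star0 V))[r r0]]; rewrite subr0 => Kre.
rewrite -[e]scale1r -(mulVf (_ : r%:C != 0)); last first.
  by rewrite gt_eqF // ltcR.
by rewrite -scalerA; apply: coneZ => //; rewrite invr_ge0 ler0c ltW.
Qed.

End Cones.

(** * The cones [Dmax] and their order unit *)

Section MaximalCones.
Local Open Scope complex_scope.
Local Open Scope sesquilinear_scope.
Variables (R : realType) (V : starLmodType R) (Vp : set V) (e : V).
Hypothesis hV : AOU_space Vp e.
Implicit Types (n m : nat) (v w : V).

Let coneVp : cone Vp. Proof. by case: hV => -[]. Qed.
Let Vp_e : Vp e.
Proof. by case: hV => _ ue _; exact: order_unit_in_cone. Qed.

Lemma Dmax_tensor n (a : 'M[R[i]]_n) v :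
  psdmx a -> Vp v -> Dmax Vp n (mxtensor a v).
Proof.
by move=> pa Vv; exists 1%N, (fun=> a), (fun=> v); split; rewrite ?big_ord1.
Qed.

(** Induction principle for [Dmax], which hides the indexed families of its definition. *)
Lemma Dmax_sub n (P : set (starmx V n)) :
  P 0 -> (forall A B, P A -> P B -> P (A + B)) ->
  (forall a v, psdmx a -> Vp v -> P (mxtensor a v)) -> Dmax Vp n `<=` P.
Proof.
move=> P0 PD PT _ [k [a [v [pa Vv ->]]]].
by apply: big_ind => // i _; exact: PT.
Qed.

Lemma DmaxD n (A B : starmx V n) :
  Dmax Vp n A -> Dmax Vp n B -> Dmax Vp n (A + B).
Proof.
move=> [k [a [v [pa Vv ->]]]] [l [b [w [pb Vw ->]]]].
exists (k + l)%N, (fun i => match split i with inl i => a i | inr i => b i end).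
exists (fun i => match split i with inl i => v i | inr i => w i end).
split=> [i|i|]; try by case: split.
rewrite big_split_ord; congr (_ + _); apply: eq_bigr => i _.
  by rewrite (unsplitK (inl i)).
by rewrite (unsplitK (inr i)).
Qed.

Lemma Dmax0 n : Dmax Vp n 0.
Proof.
have -> : (0 : starmx V n) = mxtensor 0 0.
  by rewrite -[in RHS](scale0r (0 : V)) mxtensorZr scale0r.
by apply: Dmax_tensor; [exact: psdmx0|exact: cone0].
Qed.

Lemma Dmax_cone n : cone (Dmax Vp n).
Proof.
split; [by exists 0; exact: Dmax0|exact: DmaxD|move=> r A r0].
move: A; apply: Dmax_sub => [|A B DA DB|a v pa Vv].
- by rewrite scaler0; exact: Dmax0.
- by rewrite scalerDr; exact: DmaxD.
- rewrite -mxtensorZl; apply: Dmax_tensor => //.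
  by apply: psdmxZ; rewrite ?ler0c.
Qed.

Lemma DmaxZ n (c : R[i]) (A : starmx V n) :
  0 <= c -> Dmax Vp n A -> Dmax Vp n (c *: A).
Proof. exact: (coneZ (Dmax_cone n)). Qed.

Lemma Dmax_unit n : Dmax Vp n (mxunit n e).
Proof. by rewrite mxunitE; apply: Dmax_tensor => //; exact: psdmx1. Qed.

Lemma Dmax_selfadjoint n : Dmax Vp n `<=` @selfadjoint R (starmx V n).
Proof.
apply: Dmax_sub => [|A B sA sB|a v /psdmxP[ha _] Vv]; first exact: star0.
  by rewrite /selfadjoint /= starD sA sB.
case: hV => -[_ + _] _ _ => /(_ v Vv) sv.
by rewrite /selfadjoint /= star_mxtensor ha sv.
Qed.

Lemma Dmax_compress n m (X : 'M[R[i]]_(n, m)) A :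
  Dmax Vp n A -> Dmax Vp m (mxcompress X A).
Proof.
move: A; apply: Dmax_sub => [|A B DA DB|a v pa Vv].
- by rewrite mxcompress0; exact: Dmax0.
- by rewrite mxcompressD; exact: DmaxD.
- by rewrite mxcompress_tensor; apply: Dmax_tensor => //; exact: psdmx_congr.
Qed.

(** A 1 by 1 psd matrix is a nonnegative scalar, as its form evaluated at 1 shows, and [Vp] absorbs
    such scalars. *)
Lemma Dmax1 (A : starmx V 1) : Dmax Vp 1 A -> Vp ((A : 'M[V]_1) 0 0).
Proof.
move: A; apply: Dmax_sub => [|A B VA VB|a v /psdmxP[_ pa] Vv].
- by rewrite mxE; exact: cone0.
- by rewrite starmxD_E; exact: coneD.
- rewrite mxE; apply: coneZ => //.
  by have := pa 1%:M; rewrite trmx1 map_mx1 mul1mx mulmx1.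
Qed.

(** Choose [s] with [s e >= v], then [r] with [r 1 >= s p]. The difference splits as
    [p (x) (s e - v) + (r 1 - s p) (x) e], two tensors of positive elements. *)
Lemma mxunit_bounds_psd_tensor n (p : 'M[R[i]]_n) v :
  psdmx p -> selfadjoint v ->
  exists2 r : R, 0 < r & Dmax Vp n (r%:C *: mxunit n e - mxtensor p v).
Proof.
move=> pp sv; case: hV => _ [_ /(_ v sv)[s s0 Vsv]] _.
have s0' : 0 <= s%:C by rewrite ler0c ltW.
have /psdmxP[hsp _] := psdmxZ s0' pp.
have [r r0 pr] := hermsymmx_bounded hsp.
exists r => //.
have -> : r%:C *: mxunit n e - mxtensor p v =
    mxtensor p (s%:C *: e - v) + mxtensor (r%:C%:M - s%:C *: p) e.
  rewrite mxtensorDr mxtensorDl mxtensorNr mxtensorNl mxtensorZr mxtensorZl.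
  by rewrite [RHS]addrC addrA subrK mxunitE -(scalemx1 _ r%:C) mxtensorZl.
by apply: DmaxD; exact: Dmax_tensor.
Qed.

(* [h = t - (t - h)] with both terms psd, and
   [- (t - h) (x) v = (t - h) (x) (- v)]. *)
Lemma mxunit_bounds_hermitian_tensor n (h : 'M[R[i]]_n) v :
  h^t* = h -> selfadjoint v ->
  exists2 r : R, 0 < r & Dmax Vp n (r%:C *: mxunit n e - mxtensor h v).
Proof.
move=> hh sv; have [t t0 pt] := hermsymmx_bounded hh.
have t0' : 0 <= t%:C by rewrite ler0c ltW.
have pt1 : psdmx (t%:C%:M : 'M[R[i]]_n).
  by rewrite -scalemx1; apply: psdmxZ => //; exact: psdmx1.
have sNv : selfadjoint (- v) by rewrite /selfadjoint /= starN sv.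
have [r1 r10 D1] := mxunit_bounds_psd_tensor pt1 sv.
have [r2 r20 D2] := mxunit_bounds_psd_tensor pt sNv.
exists (r1 + r2); first exact: addr_gt0.
have -> : (r1 + r2)%:C *: mxunit n e - mxtensor h v =
    (r1%:C *: mxunit n e - mxtensor t%:C%:M v) +
    (r2%:C *: mxunit n e - mxtensor (t%:C%:M - h) (- v)).
  rewrite rmorphD scalerDl addrACA -opprD; congr (_ - _).
  by rewrite mxtensorNr mxtensorDl mxtensorNl opprD opprK addrA subrr add0r.
exact: DmaxD.
Qed.

(** Bounded elements are closed under sums, so it suffices to bound [A + A = A + A^*] and halve.
    Expanding [A] in matrix units leaves terms [M (x) v + M^* (x) v^*], which are sums of hermitian
    tensors. *)
Lemma mxunit_bounds_selfadjoint n (A : starmx V n) :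
  selfadjoint A -> exists2 r : R, 0 < r & Dmax Vp n (r%:C *: mxunit n e - A).
Proof.
move=> sA.
pose bounded (B : starmx V n) :=
  exists2 r : R, 0 < r & Dmax Vp n (r%:C *: mxunit n e - B).
have bD B C : bounded B -> bounded C -> bounded (B + C).
  move=> [r r0 DB] [s s0 DC]; exists (r + s); first exact: addr_gt0.
  by rewrite rmorphD scalerDl opprD addrACA; exact: DmaxD.
have b0 : bounded 0.
  exists 1 => //; rewrite subr0 scale1r; exact: Dmax_unit.
(* Here [b] and [c] are twice the real and imaginary parts of [v], so [b + 'i c = 2 v] and
   [b - 'i c = 2 v^*]; the factor 2 is absorbed by [N = M / 2]. *)
have bT (M : 'M[R[i]]_n) v : bounded (mxtensor M v + mxtensor (M^t*) (star v)).
  pose b := v + star v; pose c := - 'i%R *: (v - star v).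
  have sb : selfadjoint b by rewrite /selfadjoint /= starD starK addrC.
  have sc : selfadjoint c.
    rewrite /selfadjoint /= starZ starD starN starK rmorphN /= conjCi opprK.
    by rewrite /c scaleNr -scalerN opprB.
  pose N : 'M[R[i]]_n := 2^-1 *: M.
  have hN (L : 'M[R[i]]_n) : (L + L^t*)^t* = L + L^t*.
    by rewrite linearD /= map_mxD trmxCK addrC.
  have -> : mxtensor M v + mxtensor (M^t*) (star v) =
      mxtensor (N + N^t*) b + mxtensor ('i%R *: N + ('i%R *: N)^t*) c.
    have -> : ('i%R *: N)^t* = - 'i%R *: N^t*.
      by rewrite linearZ /= map_mxZ /= conjCi.
    have -> : N^t* = 2^-1 *: M^t*.
      by rewrite linearZ /= map_mxZ /= fmorphV rmorph_nat.
    have bcE : b + 'i%R *: c = 2 *: v.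
      rewrite /b /c scalerA mulrN -expr2 sqrCi opprK scale1r.
      by rewrite addrACA subrr addr0 scaler_nat.
    have bcE' : b - 'i%R *: c = 2 *: star v.
      rewrite /b /c scalerA mulrN -expr2 sqrCi opprK scale1r opprB.
      by rewrite addrC addrA subrK scaler_nat.
    rewrite !mxtensorDl addrACA !mxtensorZl scaleNr -!mxtensorZr -mxtensorNr.
    have swap (w : V) : 'i%R *: (2^-1 *: w) = 2^-1 *: ('i%R *: w).
      by rewrite !scalerA mulrC.
    rewrite -!mxtensorDr swap -scalerDr -scalerBr bcE bcE' !scalerA mulVf.
      by rewrite !scale1r.
    by rewrite pnatr_eq0.
  by apply: bD; apply: mxunit_bounds_hermitian_tensor.
have [r r0 DA] : bounded (A + A).
  rewrite -{2}sA.
  have QD B C : bounded (B + star B) -> bounded (C + star C) ->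
      bounded (B + C + star (B + C)).
    by rewrite starD addrACA; exact: bD.
  have Q0 : bounded (0 + star 0) by rewrite add0r star0.
  rewrite (starmx_sum_delta A).
  apply: (big_ind (fun B => bounded (B + star B))) => // i _.
  apply: (big_ind (fun B => bounded (B + star B))) => // j _.
  by rewrite star_mxtensor.
exists (2^-1 * r); first by rewrite mulr_gt0 ?invr_gt0.
have := @DmaxZ n _ _ (_ : 0 <= 2^-1) DA.
rewrite invr_ge0 ler0n => /(_ isT); congr Dmax.
rewrite scalerBr; congr (_ - _).
  have half_r (B : starmx V n) : 2^-1 *: (r%:C *: B) = (2^-1 * r)%:C *: B.
    by rewrite scalerA rmorphM fmorphV rmorph_nat.
  exact: half_r.
have halfK (B : starmx V n) : 2^-1 *: (B + B) = B.
  by rewrite scalerDr -scalerDl -[X in X + X]mul1r -splitr scale1r.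
exact: halfK.
Qed.

(** * The Archimedean closure [Cmax] and its universal property *)

Lemma Dmax_sub_Cmax n : Dmax Vp n `<=` Cmax Vp e n.
Proof.
move=> A DA r r0; apply: DmaxD => //.
by apply: DmaxZ; [by rewrite ler0c ltW|exact: Dmax_unit].
Qed.

(** Compression turns [e_n] into [X^* X (x) e] rather than [e_m]. With [X^* X <= t 1] and
    [s = r / t], the defect [s (t 1 - X^* X) (x) e] lies in [Dmax]. *)
Lemma Cmax_compress n m (X : 'M[R[i]]_(n, m)) A :
  Cmax Vp e n A -> Cmax Vp e m (mxcompress X A).
Proof.
move=> CA r r0.
have hXX : (X^t* *m X)^t* = X^t* *m X by rewrite trmxC_mul trmxCK.
have [t t0 pt] := hermsymmx_bounded hXX.
pose s := r / t; have s0 : 0 < s by rewrite divr_gt0.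
have -> : r%:C *: mxunit m e + mxcompress X A =
    s%:C *: mxtensor (t%:C%:M - X^t* *m X) e +
    mxcompress X (s%:C *: mxunit n e + A).
  rewrite mxcompressD mxcompressZ addrA; congr (_ + _).
  rewrite !mxunitE mxcompress_tensor mulmx1 -scalerDr -mxtensorDl subrK.
  rewrite -(scalemx1 _ t%:C) mxtensorZl scalerA -rmorphM /s divfK //.
  by rewrite gt_eqF.
apply: DmaxD; last by apply: Dmax_compress; exact: CA.
apply: DmaxZ; first by rewrite ler0c ltW.
exact: Dmax_tensor.
Qed.

Lemma Cmax_archimedean n (A : starmx V n) :
  (forall r : R, 0 < r -> Cmax Vp e n (r%:C *: mxunit n e + A)) ->
  Cmax Vp e n A.
Proof.
move=> CA r r0; have r20 : 0 < r / 2 by rewrite divr_gt0.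
by have := CA _ r20 _ r20; rewrite addrA -scalerDl -rmorphD -splitr.
Qed.

Lemma Cmax1 (A : starmx V 1) : Cmax Vp e 1 A -> Vp ((A : 'M[V]_1) 0 0).
Proof.
move=> CA; case: hV => _ _; apply => r r0.
by have := Dmax1 (CA r r0); rewrite starmxD_E starmxZ_E [in X in Vp X]mxE.
Qed.

Lemma first_cone_Cmax : first_cone (Cmax Vp e) = Vp.
Proof.
apply/seteqP; split=> v; first by move/Cmax1; rewrite mxE.
move=> Vv; apply: Dmax_sub_Cmax; rewrite const_mx1E.
by apply: Dmax_tensor => //; exact: psdmx1.
Qed.

Lemma Cmax_cone n : cone (Cmax Vp e n).
Proof.
split.
- by exists 0; apply: Dmax_sub_Cmax; exact: Dmax0.
- move=> A B CA CB; apply: Cmax_archimedean => r r0.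
  have r20 : 0 < r / 2 by rewrite divr_gt0.
  apply: Dmax_sub_Cmax; rewrite (splitr r) rmorphD scalerDl addrACA.
  by apply: DmaxD; [exact: CA|exact: CB].
- move=> r A; rewrite le_eqVlt => /predU1P[<- _|r0 CA].
    by rewrite scale0r; apply: Dmax_sub_Cmax; exact: Dmax0.
  (* [s e_n + r A] is [r] times [(s / r) e_n + A], hence the separate treatment of [r = 0]. *)
  move=> s s0; have sr0 : 0 < s / r by rewrite divr_gt0.
  have := @DmaxZ n _ _ (_ : 0 <= r%:C) (CA _ sr0).
  rewrite ler0c ltW // => /(_ isT).
  by rewrite scalerDr scalerA -rmorphM mulrC divfK // gt_eqF.
Qed.

(** Both [e_n + A] and [e_n] lie in [Dmax], hence are self-adjoint, and [e_n] cancels. *)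
Lemma Cmax_selfadjoint n : Cmax Vp e n `<=` @selfadjoint R (starmx V n).
Proof.
move=> A /(_ 1 ltr01) /Dmax_selfadjoint; rewrite /selfadjoint /= scale1r starD.
by rewrite (Dmax_selfadjoint (Dmax_unit n)) => /addrI.
Qed.

Lemma Cmax_ordered_star_space n : ordered_star_space (Cmax Vp e n).
Proof.
split; [exact: Cmax_cone|exact: Cmax_selfadjoint|].
apply/seteqP; split=> A /=; last first.
  by move->; split; [|exists 0; rewrite ?oppr0 //]; exact: cone0 (Cmax_cone n).
(* With [A = - B] and both in [Cmax], each [x^* B x] lies in [Vp] and in [- Vp], so it vanishes;
   polarization then gives [A = 0]. *)
move=> [CA [B CB AE]]; apply: mxcompress_eq0 => x.
have := Cmax1 (Cmax_compress x CB); have := Cmax1 (Cmax_compress x CA).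
rewrite -AE mxcompressN starmxN_E => VN Vx.
case: hV => -[_ _ VpN] _ _.
suff : [set 0] ((mxcompress x B : 'M[V]_1) 0 0).
  move=> /= x0; apply/matrixP => i j.
  by rewrite starmxN_E !ord1 x0 oppr0 mxE.
rewrite -VpN; split=> //.
by exists (- (mxcompress x B : 'M[V]_1) 0 0); rewrite ?opprK.
Qed.

Lemma Cmax_matrix_ordering : matrix_ordering (Cmax Vp e).
Proof.
split=> [n _|n m _ _ X A]; first exact: Cmax_ordered_star_space.
exact: Cmax_compress.
Qed.

Lemma Cmax_operator_system : operator_system (Cmax Vp e) e.
Proof.
split; [exact: Cmax_matrix_ordering|by case: hV => _ []|move=> n _].
split; [exact: Cmax_ordered_star_space| |exact: Cmax_archimedean].
split; first exact: (Dmax_selfadjoint (Dmax_unit n)).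
move=> A /mxunit_bounds_selfadjoint[r r0 DA]; exists r => //.
exact: Dmax_sub_Cmax.
Qed.

Lemma Cmax_completely_positive (S : starLmodType R)
    (D : forall n, set (starmx S n)) (f : S) (phi : {linear V -> S}) :
  operator_system D f -> unital e f phi -> positive Vp (first_cone D) phi ->
  completely_positive (Cmax Vp e) D phi.
Proof.
move=> [[ordD comprD] _ aouD] phi_e phi_p n n0 A CA.
have [[coneDn _ _] _ archD] := aouD n n0.
have phiD : Dmax Vp n `<=` [set B | D n (map_mx phi B : starmx S n)].
  apply: Dmax_sub => [|B C DB DC|a v /psdmx_factor[b ->] Vv] /=.
  - have -> : map_mx phi (0 : 'M[V]_n) = 0.
      by apply/matrixP=> i j; rewrite !mxE linear0.
    exact: cone0 coneDn.
  - have -> : map_mx phi (B + C : 'M[V]_n) = map_mx phi B + map_mx phi C.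
      by apply/matrixP=> i j; rewrite !mxE linearD.
    exact: (coneD coneDn).
  - rewrite map_mxtensor mxtensor_factor; apply: (cone_sum coneDn) => k.
    by apply: comprD => //; exact: phi_p.
(* As [phi e = f], the image of [r e_n + A] is [r f_n + phi_n(A)], so the Archimedean property of
   [D n] removes the perturbation. *)
apply: archD => r r0; have := phiD _ (CA r r0) => /=.
congr (D n _); apply/matrixP => i j.
by rewrite starmxD_E starmxZ_E !mxE linearD linearZ raddfMn /= phi_e.
Qed.

End MaximalCones.

Theorem theorem3p22 (R : realType) (V : starLmodType R) (Vp : set V) (e : V)
    (hV : AOU_space Vp e) :
  [/\ operator_system_structure Vp e (Cmax Vp e),
      (forall P : forall n, set (starmx V n),
         operator_system_structure Vp e P ->
         forall n, (0 < n)%N -> Cmax Vp e n `<=` P n),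
      (forall (S : starLmodType R) (D : forall n, set (starmx S n)) (f : S),
         operator_system D f ->
         forall phi : {linear V -> S},
           unital e f phi -> positive Vp (first_cone D) phi ->
           completely_positive (Cmax Vp e) D phi) &
      (forall C : forall n, set (starmx V n),
         operator_system_structure Vp e C ->
         (forall (W : starLmodType R) (D : forall n, set (starmx W n)) (f : W),
            operator_system D f ->
            forall psi : {linear V -> W},
              unital e f psi -> positive (first_cone C) (first_cone D) psi ->
              completely_positive C D psi) ->
         unital e e (idfun : V -> V) /\
         complete_order_isomorphism C (Cmax Vp e) (idfun : {linear V -> V}))].
Proof.
(* The identity is positive into any structure with first cone [Vp]; this yields both minimality of
   [Cmax] and the backward half of the final isomorphism. *)
have Cmax_id P : operator_system_structure Vp e P ->
    completely_positive (Cmax Vp e) P (idfun : V -> V).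
  move=> [_ P1 opP].
  have pos_id : positive Vp (first_cone P) idfun by rewrite P1.
  exact: (Cmax_completely_positive (phi := idfun) opP erefl pos_id).
split.
- split; [exact: Cmax_matrix_ordering|exact: first_cone_Cmax|].
  exact: Cmax_operator_system.
- by move=> P opP n n0 A CA; have := Cmax_id P opP n n0 A CA; rewrite map_mx_id.
- by move=> S D f opD phi; exact: Cmax_completely_positive.
- move=> C opC univC; split=> //; exists idfun; split=> //; last exact: Cmax_id.
  (* The forward half applies the universal property assumed of [C] to the target [Cmax], whose
     first cone is also [Vp]. *)
  have pos_id : positive (first_cone C) (first_cone (Cmax Vp e)) idfun.
    by case: opC => _ C1 _; rewrite C1 (first_cone_Cmax hV).
  exact: (univC V _ e (Cmax_operator_system hV) idfun).
Qed.
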